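(* Let $(H,\boldsymbol g)$ be a finite-dimensional pivotal Hopf algebra over a field $\Bbbk$ and let $A\subset H$ be a unimodular Hopf subalgebra such that $\boldsymbol g\in A$. Let $\mathcal I_A\subset H\text{-mod}$ be the tensor ideal of those $V\in H$-mod whose restriction $\mathrm{Res}(V)$ to $A$ is a projective $A$-module. Then there is a right (respectively left) modified trace on $\mathcal I_A$, given by the pull-back $$\mathsf t_V(f):=\mathsf t^A_{\mathrm{Res}(V)}\bigl(\mathrm{Res}(f)\bigr),\qquad V\in\mathcal I_A,\ f\in\mathrm{End}_H(V),$$ where $\mathsf t^A$ is the non-degenerate right (respectively left) modified trace on $A$-pmod.
   Context: $H$-mod is the category of finite-dimensional left $H$-modules; $A$-pmod is the category of finite-dimensional projective left $A$-modules; $\mathrm{Res}\colon H\text{-mod}\to A\text{-mod}$ is restriction. A pivotal Hopf algebra $(H,\boldsymbol g)$ is a Hopf algebra with a group-like $\boldsymbol g$ such that $S^2(a)=\boldsymbol g a\boldsymbol g^{-1}$; then $(A,\boldsymbol g)$ is also pivotal. A finite-dimensional Hopf algebra is unimodular if its spaces of left and right cointegrals coincide. For $K\in\{H,A\}$ and $V\in K$-mod with basis $\{v_i\}$: $\mathrm{ev}_V(\xi\otimes v)=\xi(v)$, $\mathrm{coev}_V(1)=\sum v_i\otimes v_i^*$, $\widetilde{\mathrm{ev}}_V(v\otimes\xi)=\xi(\boldsymbol g v)$, $\widetilde{\mathrm{coev}}_V(1)=\sum v_i^*\otimes\boldsymbol g^{-1}v_i$. A right modified trace on a tensor ideal $\mathcal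 I\subset K$-mod (a full subcategory closed under retracts and tensoring with objects of $K$-mod) is a family of linear maps $\{\mathsf t_X\colon\mathrm{End}_K(X)\to\Bbbk\}_{X\in\mathcal I}$ with $\mathsf t_X(g\circ f)=\mathsf t_Y(f\circ g)$ for $f\colon X\to Y$, $g\colon Y\to X$, and $\mathsf t_{X\otimes V}(f)=\mathsf t_X\bigl((\mathrm{id}_X\otimes\widetilde{\mathrm{ev}}_V)(f\otimes\mathrm{id}_{V^*})(\mathrm{id}_X\otimes\mathrm{coev}_V)\bigr)$ for $X\in\mathcal I$, $V\in K$-mod, $f\in\mathrm{End}_K(X\otimes V)$. A left modified trace satisfies instead $\mathsf t_{V\otimes X}(f)=\mathsf t_X\bigl((\mathrm{ev}_V\otimes\mathrm{id}_X)(\mathrm{id}_{V^*}\otimes f)(\widetilde{\mathrm{coev}}_V\otimes\mathrm{id}_X)\bigr)$. Known background fact: since $(A,\boldsymbol g)$ is pivotal and unimodular, $A$-pmod (as an ideal of $A$-mod) has a non-degenerate right (left) modified trace $\mathsf t^A$, unique up to scalar, with $\mathsf t^A_A(f)=\boldsymbol\mu(\boldsymbol g f(1))$ (respectively $\boldsymbol\mu^l(\boldsymbol g^{-1}f(1))$) for $f\in\mathrm{End}_A(A)$, where $\boldsymbol\mu$ ($\boldsymbol\mu^l$) is a nonzero right (left) integral of $A$, i.e. $(\boldsymbol\mu\otimes\mathrm{id})\Delta(a)=\boldsymbol\mu(a)1$ (respectively $(\mathrm{id}\otimes\boldsymbol\mu^l)\Delta(a)=\boldsymbol\mu^l(a)1$).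 Non-degenerate means that the pairings $\mathrm{Hom}_A(P',P)\times\mathrm{Hom}_A(P,P')\to\Bbbk$, $(f,g)\mapsto\mathsf t^A_P(f\circ g)$, are non-degenerate. *)

(* Defs.v *)
From HB Require Import structures.
From mathcomp Require Import all_boot all_algebra all_field.

Set Implicit Arguments.
Unset Strict Implicit.
Unset Printing Implicit Defensive.

Import GRing.Theory.
Local Open Scope ring_scope.

Section TensorSpace.
Variable k : fieldType.
Implicit Types U V W : vectType k.

Definition bvec V (i : 'I_(\dim {:V})) : V := (vbasis {:V})`_i.
Definition bcoord V (i : 'I_(\dim {:V})) : V -> k := coord (vbasis {:V}) i.
HB.instance Definition _ V i := GRing.Linear.on (@bcoord V i).

(* Model of the tensor product: the matrix T stands for
   \sum_i \sum_j T i j *: (bvec i (x) bvec j).  The lemmas tlift_pure, tens_sum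
   and tens_ext below are its universal property; nothing else about the model
   is used in the definitions. *)
Definition tens V W : vectType k := 'M[k]_(\dim {:V}, \dim {:W}).

Definition pure V W (v : V) (w : W) : tens V W :=
  \matrix_(i, j) (bcoord i v * bcoord j w).

(* The linear map V (x) W -> U induced by a bilinear f. *)
Definition tlift V W (U : lmodType k) (f : V -> W -> U) (T : tens V W) : U :=
  \sum_i \sum_j T i j *: f (bvec i) (bvec j).

Definition bilin V W (U : lmodType k) (f : V -> W -> U) :=
  (forall w, linear (f^~ w)) /\ (forall v, linear (f v)).

Lemma tlift_is_linear V W (U : lmodType k) (f : V -> W -> U) : linear (tlift f).
Proof.
move=> a S T; rewrite /tlift scaler_sumr -big_split /=; apply: eq_bigr => i _.
rewrite scaler_sumr -big_split /=; apply: eq_bigr => j _.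
by rewrite !mxE scalerDl scalerA.
Qed.
HB.instance Definition _ V W (U : lmodType k) (f : V -> W -> U) :=
  GRing.isLinear.Build k (tens V W) U _ (tlift f) (tlift_is_linear f).

Lemma bvec_sum V (v : V) : v = \sum_i bcoord i v *: bvec i.
Proof. exact/coord_vbasis/memvf. Qed.

Lemma bcoord_bvec V (i j : 'I_(\dim {:V})) : bcoord i (bvec j) = (i == j)%:R.
Proof.
by rewrite /bcoord /bvec coord_free ?(basis_free (vbasisP _)) // eq_sym.
Qed.

Section Bilin.
Variables (V W : vectType k) (U : lmodType k) (f : V -> W -> U).
Hypothesis fB : bilin f.
Lemma bilin_suml I (r : seq I) (c : I -> k) (v : I -> V) w :
  f (\sum_(i <- r) c i *: v i) w = \sum_(i <- r) c i *: f (v i) w.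
Proof.
pose g : {linear V -> U} :=
  HB.pack (f^~ w) (GRing.isLinear.Build _ _ _ _ _ (fB.1 w)).
rewrite -[LHS]/(g _) linear_sum; apply: eq_bigr => i _; exact: linearZ.
Qed.
Lemma bilin_sumr I (r : seq I) (c : I -> k) v (w : I -> W) :
  f v (\sum_(i <- r) c i *: w i) = \sum_(i <- r) c i *: f v (w i).
Proof.
pose g : {linear W -> U} :=
  HB.pack (f v) (GRing.isLinear.Build _ _ _ _ _ (fB.2 v)).
rewrite -[LHS]/(g _) linear_sum; apply: eq_bigr => i _; exact: linearZ.
Qed.

Lemma tlift_pure v w : tlift f (pure v w) = f v w.
Proof.
rewrite [in RHS](bvec_sum v) bilin_suml; apply: eq_bigr => i _.
rewrite [in RHS](bvec_sum w) bilin_sumr scaler_sumr; apply: eq_bigr => j _.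
by rewrite scalerA !mxE.
Qed.
End Bilin.

Lemma pure_bilin V W : bilin (@pure V W).
Proof.
split=> [w a v v' | v a w w']; apply/matrixP => i j; rewrite !mxE linearP /=.
  by rewrite mulrDl mulrA.
by rewrite mulrDr mulrCA.
Qed.

Lemma tens_sum V W (T : tens V W) :
  T = \sum_i \sum_j T i j *: pure (bvec i) (bvec j).
Proof.
rewrite [LHS]matrix_sum_delta; apply: eq_bigr => i _; apply: eq_bigr => j _.
congr (_ *: _); apply/matrixP=> a b; rewrite !mxE !bcoord_bvec.
by rewrite -natrM mulnb.
Qed.

Lemma tens_ext V W (U : lmodType k) (f g : {linear tens V W -> U}) :
  (forall v w, f (pure v w) = g (pure v w)) -> f =1 g.
Proof.
move=> efg T; rewrite (tens_sum T) !linear_sum; apply: eq_bigr => i _.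
rewrite !linear_sum; apply: eq_bigr => j _; rewrite !linearZ /=.
by rewrite efg.
Qed.

Lemma eq_tlift V W (U : lmodType k) (f g : V -> W -> U) :
  (forall v w, f v w = g v w) -> tlift f =1 tlift g.
Proof.
by move=> e T; apply: eq_bigr => i _; apply: eq_bigr => j _; rewrite e.
Qed.

Lemma linear_tlift V W (U U' : lmodType k) (h : {linear U -> U'})
  (f : V -> W -> U) T : h (tlift f T) = tlift (fun v w => h (f v w)) T.
Proof.
rewrite linear_sum; apply: eq_bigr => i _; rewrite linear_sum.
by apply: eq_bigr => j _; rewrite linearZ.
Qed.


Lemma tliftE V W (U : lmodType k) (h : {linear tens V W -> U}) T :
  h T = tlift (fun v w => h (pure v w)) T.
Proof.
rewrite [in LHS](tens_sum T) linear_sum; apply: eq_bigr => i _.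
by rewrite linear_sum; apply: eq_bigr => j _; rewrite linearZ.
Qed.

Lemma tlift_linl V W (U : lmodType k) (f g : V -> W -> U) a T :
  tlift (fun v w => a *: f v w + g v w) T = a *: tlift f T + tlift g T.
Proof.
rewrite /tlift scaler_sumr -big_split; apply: eq_bigr => i _ /=.
rewrite scaler_sumr -big_split; apply: eq_bigr => j _ /=.
by rewrite scalerDr !scalerA mulrC.
Qed.

Definition tmap V W V' W' (f : 'Hom(V, V')) (g : 'Hom(W, W')) :
    'Hom(tens V W, tens V' W') :=
  linfun (tlift (fun v w => pure (f v) (g w))).

(* The associativity and unit constraints of vector spaces. *)
Definition tassoc U V W : 'Hom(tens (tens U V) W, tens U (tens V W)) :=
  linfun (tlift (fun t w => tlift (fun u v => pure u (pure v w)) t)).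
Definition tassocV U V W : 'Hom(tens U (tens V W), tens (tens U V) W) :=
  linfun (tlift (fun u t => tlift (fun v w => pure (pure u v) w) t)).
Definition tunitr V : 'Hom(tens V k^o, V) :=
  linfun (tlift (fun v (c : k^o) => c *: v)).
Definition tunitrV V : 'Hom(V, tens V k^o) :=
  linfun (fun v => pure v (1 : k^o)).
Definition tunitl V : 'Hom(tens k^o V, V) :=
  linfun (tlift (fun (c : k^o) v => c *: v)).
Definition tunitlV V : 'Hom(V, tens k^o V) :=
  linfun (fun v => pure (1 : k^o) v).

Lemma pureDl V W (a : k) (v v' : V) (w : W) :
  pure (a *: v + v') w = a *: pure v w + pure v' w.
Proof. exact: (pure_bilin V W).1. Qed.
Lemma pureDr V W (a : k) (v : V) (w w' : W) :
  pure v (a *: w + w') = a *: pure v w + pure v w'.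
Proof. exact: (pure_bilin V W).2. Qed.

Lemma linfunE V W (f : V -> W) : linear f -> linfun f =1 f.
Proof.
move=> fL v; pose g : {linear V -> W} :=
  HB.pack f (GRing.isLinear.Build _ _ _ _ _ fL).
by rewrite -[f]/(g : V -> W) lfunE.
Qed.

Lemma tmap_pure V W V' W' (f : 'Hom(V, V')) (g : 'Hom(W, W')) v w :
  tmap f g (pure v w) = pure (f v) (g w).
Proof.
rewrite lfunE /= tlift_pure //.
by split=> [y a x x'|x a y y']; rewrite linearP ?pureDl ?pureDr.
Qed.

Lemma lfun_tens_ext V W U (f g : 'Hom(tens V W, U)) :
  (forall v w, f (pure v w) = g (pure v w)) -> f = g.
Proof. by move=> e; apply/lfunP/tens_ext. Qed.

Lemma tmap_comp V W V' W' V'' W'' (f : 'Hom(V, V')) (g : 'Hom(W, W'))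
  (f' : 'Hom(V', V'')) (g' : 'Hom(W', W'')) :
  (tmap f' g' \o tmap f g)%VF = tmap (f' \o f) (g' \o g).
Proof.
by apply: lfun_tens_ext => v w; rewrite lfunE /= !tmap_pure !lfunE.
Qed.

Lemma tmap_id V W : tmap \1%VF \1%VF = \1%VF :> 'End(tens V W).
Proof. by apply: lfun_tens_ext => v w; rewrite tmap_pure !lfunE. Qed.

Lemma tassoc_pure U V W (u : U) (v : V) (w : W) :
  tassoc U V W (pure (pure u v) w) = pure u (pure v w).
Proof.
have B y : bilin (fun u v => pure u (pure v y) : tens U (tens V W)).
  by split=> ? ? ? ?; rewrite ?pureDl ?pureDr.
rewrite lfunE /= tlift_pure; first exact: (tlift_pure (B w)).
split=> [y a x x'|x a y y']; first exact: linearP.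
by rewrite -tlift_linl; apply: eq_tlift => *; rewrite !pureDr.
Qed.

Lemma tassocV_pure U V W (u : U) (v : V) (w : W) :
  tassocV U V W (pure u (pure v w)) = pure (pure u v) w.
Proof.
have B x : bilin (fun v w => pure (pure x v) w : tens (tens U V) W).
  by split=> ? ? ? ?; rewrite ?pureDr ?pureDl.
rewrite lfunE /= tlift_pure; first exact: (tlift_pure (B u)).
split=> [y a x x'|x a y y'].
  by rewrite -tlift_linl; apply: eq_tlift => *; rewrite !pureDl.
exact: linearP.
Qed.

Lemma tunitl_pure V (c : k^o) (v : V) :
  tunitl V (pure c v) = c *: v.
Proof.
rewrite lfunE /= tlift_pure //; split=> [w a x y|w a x y] /=.
  by rewrite scalerDl scalerA.
by rewrite scalerDr !scalerA mulrC.
Qed.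

Lemma tunitr_pure V (c : k^o) (v : V) :
  tunitr V (pure v c) = c *: v.
Proof.
rewrite lfunE /= tlift_pure //; split=> [w a x y|w a x y] /=.
  by rewrite scalerDr !scalerA mulrC.
by rewrite scalerDl scalerA.
Qed.

Lemma tlift_tmap V W V' W' (U : lmodType k) (f : V' -> W' -> U)
  (g : 'Hom(V, V')) (h : 'Hom(W, W')) T : bilin f ->
  tlift f (tmap g h T) = tlift (fun v w => f (g v) (h w)) T.
Proof.
move=> fB; rewrite [in LHS]lfunE /= linear_tlift; apply: eq_tlift => v w.
exact: tlift_pure.
Qed.

Lemma tlift_lfunE V W U U' (f : V -> W -> 'Hom(U, U')) T u :
  tlift f T u = tlift (fun x y => f x y u) T.
Proof.
rewrite sum_lfunE; apply: eq_bigr => i _; rewrite sum_lfunE.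
by apply: eq_bigr => j _; rewrite scale_lfunE.
Qed.

End TensorSpace.
Arguments pure {k V W}.
Arguments tassoc {k}.
Arguments tassocV {k}.
Arguments tunitr {k}.
Arguments tunitrV {k}.
Arguments tunitl {k}.
Arguments tunitlV {k}.

Section Hopf.
Variable k : fieldType.

Definition tmul (H : falgType k) (S T : tens H H) : tens H H :=
  tlift (fun a b => tlift (fun c d => pure (a * c) (b * d)) T) S.

(* Sweedler sums \sum f(a', a'') are written tlift f (comul a). *)
Record hopfAlg (H : falgType k) := HopfAlg {
  comul : 'Hom(H, tens H H);
  counit : 'Hom(H, k^o);
  antipode : 'End(H);
  coassoc : forall a, tassoc H H H (tmap comul \1%VF (comul a)) =
                      tmap \1%VF comul (comul a);
  counitl : forall a, tunitl H (tmap counit \1%VF (comul a)) = a;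
  counitr : forall a, tunitr H (tmap \1%VF counit (comul a)) = a;
  comulM : forall a b, comul (a * b) = tmul (comul a) (comul b);
  comul1 : comul 1 = pure 1 1;
  counitM : forall a b, counit (a * b) = counit a * counit b;
  counit1 : counit 1 = 1;
  antipodel : forall a,
    tlift (fun x y => antipode x * y) (comul a) = counit a *: (1 : H);
  antipoder : forall a,
    tlift (fun x y => x * antipode y) (comul a) = counit a *: (1 : H)
}.

Definition grouplike (H : falgType k) (hH : hopfAlg H) (g : H) :=
  comul hH g = pure g g /\ counit hH g = 1.

Definition pivotal (H : falgType k) (hH : hopfAlg H) (g : H) :=
  grouplike hH g /\
  forall a, antipode hH (antipode hH a) = g * a * g^-1.

Definition left_cointegral (H : falgType k) (hH : hopfAlg H) (c : H) :=
  forall a, a * c = counit hH a *: c.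
Definition right_cointegral (H : falgType k) (hH : hopfAlg H) (c : H) :=
  forall a, c * a = counit hH a *: c.
Definition unimodular (H : falgType k) (hH : hopfAlg H) :=
  forall c, left_cointegral hH c <-> right_cointegral hH c.

Lemma tmul_pure (H : falgType k) (a b c d : H) :
  tmul (pure a b) (pure c d) = pure (a * c) (b * d).
Proof.
rewrite /tmul tlift_pure ?tlift_pure //.
  by split=> ? ? ? ?; rewrite mulrDr -scalerAr ?pureDl ?pureDr.
by split=> ? ? ? ?; rewrite -tlift_linl; apply: eq_tlift => *;
  rewrite mulrDl -scalerAl ?pureDl ?pureDr.
Qed.
End Hopf.

Section HopfSub.
Variables (k : fieldType) (H : falgType k) (hH : hopfAlg H) (A : {aspace H}).

Definition sub_inc : 'Hom(subvs_of A, H) := linfun vsval.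
Definition sub_proj : 'Hom(H, subvs_of A) := linfun (vsproj A).

(* {aspace H} only provides closure under products: its unit may differ
   from that of H. *)
Record hopf_subalg : Prop := HopfSubalg {
  hsub1 : 1 \in A;
  hsub_comul : forall a, a \in A -> comul hH a \in limg (tmap sub_inc sub_inc);
  hsub_antipode : forall a, a \in A -> antipode hH a \in A
}.

Hypothesis hA : hopf_subalg.

(* Since comul hH maps A into A (x) A, projecting H onto A componentwise merely
   corestricts it; see sub_comulE. *)
Definition sub_comul : 'Hom(subvs_of A, tens (subvs_of A) (subvs_of A)) :=
  (tmap sub_proj sub_proj \o comul hH \o sub_inc)%VF.
Definition sub_counit : 'Hom(subvs_of A, k^o) := (counit hH \o sub_inc)%VF.
Definition sub_antipode : 'End(subvs_of A) :=
  (sub_proj \o antipode hH \o sub_inc)%VF.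

Lemma sub_incE a : sub_inc a = vsval a. Proof. by rewrite lfunE. Qed.
Lemma sub_incK : (sub_proj \o sub_inc)%VF = \1%VF.
Proof. by apply/lfunP => a; rewrite !lfunE /= !lfunE /= vsvalK. Qed.
Lemma sub_inc_inj : injective sub_inc.
Proof. by move=> a b; rewrite !sub_incE; apply: val_inj. Qed.
Lemma sub_inc1 : sub_inc 1 = 1.
Proof. by rewrite sub_incE; apply/eqP; rewrite /= algid_eq1 (hsub1 hA). Qed.
Lemma sub_incM a b : sub_inc (a * b) = sub_inc a * sub_inc b.
Proof. by rewrite !sub_incE. Qed.

Lemma sub_comulE a :
  tmap sub_inc sub_inc (sub_comul a) = comul hH (sub_inc a).
Proof.
have /(hsub_comul hA) /memv_imgP[T _ E]: vsval a \in A by exact: subvsP.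
rewrite !comp_lfunE sub_incE E -!comp_lfunE.
by rewrite !tmap_comp sub_incK comp_lfun1r.
Qed.
Lemma sub_antipodeE a : sub_inc (sub_antipode a) = antipode hH (sub_inc a).
Proof.
rewrite !comp_lfunE !sub_incE !lfunE /= vsprojK //.
exact/(hsub_antipode hA)/subvsP.
Qed.
Lemma sub_counitE a : sub_counit a = counit hH (sub_inc a).
Proof. by rewrite comp_lfunE. Qed.

Lemma tmap_inc_inj : injective (tmap sub_inc sub_inc).
Proof.
apply: (can_inj (g := tmap sub_proj sub_proj)) => T.
by rewrite -comp_lfunE tmap_comp !sub_incK tmap_id id_lfunE.
Qed.

Lemma tmap_inc3_inj : injective (tmap sub_inc (tmap sub_inc sub_inc)).
Proof.
apply: (can_inj (g := tmap sub_proj (tmap sub_proj sub_proj))) => T.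
by rewrite -comp_lfunE !tmap_comp !sub_incK !tmap_id id_lfunE.
Qed.

Let comul_inc :
  (tmap sub_inc sub_inc \o sub_comul)%VF = (comul hH \o sub_inc)%VF.
Proof. by apply/lfunP => a; rewrite comp_lfunE sub_comulE comp_lfunE. Qed.

Lemma sub_coassoc a :
  tassoc _ _ _ (tmap sub_comul \1%VF (sub_comul a)) =
  tmap \1%VF sub_comul (sub_comul a).
Proof.
apply: tmap_inc3_inj.
have E1 T : tmap sub_inc (tmap sub_inc sub_inc) (tmap \1%VF sub_comul T) =
    tmap \1%VF (comul hH) (tmap sub_inc sub_inc T).
  by rewrite -2!comp_lfunE !tmap_comp comul_inc comp_lfun1r comp_lfun1l.
have E2 T : tmap (tmap sub_inc sub_inc) sub_inc (tmap sub_comul \1%VF T) =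
    tmap (comul hH) \1%VF (tmap sub_inc sub_inc T).
  by rewrite -2!comp_lfunE !tmap_comp comul_inc comp_lfun1r comp_lfun1l.
rewrite E1 sub_comulE -coassoc -sub_comulE -E2; set T := tmap _ _ (_ a).
have L (f g : 'Hom(tens (tens (subvs_of A) (subvs_of A)) (subvs_of A),
    tens H (tens H H))) : (forall x y z, f (pure (pure x y) z) =
    g (pure (pure x y) z)) -> f = g.
  move=> e; apply: lfun_tens_ext => u z.
  have pl : linear (fun u : tens (subvs_of A) (subvs_of A) => pure u z).
    by move=> ? ? ?; rewrite pureDl.
  have /lfunP/(_ u) : (f \o linfun (fun u => pure u z) =
      g \o linfun (fun u => pure u z))%VF.
    by apply: lfun_tens_ext => x y; rewrite !comp_lfunE !(linfunE pl).
  by rewrite !comp_lfunE !(linfunE pl).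
have /lfunP/(_ T) : (tmap sub_inc (tmap sub_inc sub_inc) \o tassoc _ _ _ =
    tassoc _ _ _ \o tmap (tmap sub_inc sub_inc) sub_inc)%VF.
  apply: L => x y z.
  by rewrite !comp_lfunE tassoc_pure !tmap_pure tassoc_pure.
by rewrite !comp_lfunE.
Qed.

Lemma sub_counitl a : tunitl _ (tmap sub_counit \1%VF (sub_comul a)) = a.
Proof.
have E T : sub_inc (tunitl _ (tmap sub_counit \1%VF T)) =
    tunitl _ (tmap (counit hH) \1%VF (tmap sub_inc sub_inc T)).
  have /lfunP/(_ T) : (sub_inc \o (tunitl _ \o tmap sub_counit \1%VF) =
      tunitl _ \o (tmap (counit hH) \1%VF \o tmap sub_inc sub_inc))%VF.
    apply: lfun_tens_ext => x y.
    rewrite !comp_lfunE !tmap_pure !tunitl_pure linearZ /=.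
    by rewrite !id_lfunE sub_counitE.
  by rewrite !comp_lfunE.
by apply: sub_inc_inj; rewrite E sub_comulE counitl.
Qed.

Lemma sub_counitr a : tunitr _ (tmap \1%VF sub_counit (sub_comul a)) = a.
Proof.
have E T : sub_inc (tunitr _ (tmap \1%VF sub_counit T)) =
    tunitr _ (tmap \1%VF (counit hH) (tmap sub_inc sub_inc T)).
  have /lfunP/(_ T) : (sub_inc \o (tunitr _ \o tmap \1%VF sub_counit) =
      tunitr _ \o (tmap \1%VF (counit hH) \o tmap sub_inc sub_inc))%VF.
    apply: lfun_tens_ext => x y.
    rewrite !comp_lfunE !tmap_pure !tunitr_pure linearZ /=.
    by rewrite !id_lfunE sub_counitE.
  by rewrite !comp_lfunE.
by apply: sub_inc_inj; rewrite E sub_comulE counitr.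
Qed.

Lemma tmul_inc S T :
  tmap sub_inc sub_inc (tmul S T) =
  tmul (tmap sub_inc sub_inc S) (tmap sub_inc sub_inc T).
Proof.
have tl (K : falgType k) (T' : tens K K) : linear (fun S' => tmul S' T').
  by move=> ? ? ?; apply: linearP.
have tr (K : falgType k) (S' : tens K K) : linear (tmul S').
  move=> ? ? ?; rewrite /tmul -tlift_linl; apply: eq_tlift => x y.
  exact: linearP.
pose R (K : falgType k) (T' : tens K K) := linfun (fun S' => tmul S' T').
pose L (K : falgType k) (S' : tens K K) := linfun (tmul S').
have RE K T' S' : R K T' S' = tmul S' T' by rewrite linfunE.
have LE K S' T' : L K S' T' = tmul S' T' by rewrite linfunE.
have E a b : (tmap sub_inc sub_inc \o L _ (pure a b) =
    L _ (pure (sub_inc a) (sub_inc b)) \o tmap sub_inc sub_inc)%VF.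
  apply: lfun_tens_ext => c d.
  by rewrite !comp_lfunE tmap_pure !LE !tmul_pure tmap_pure !sub_incM.
have /lfunP/(_ S) : (tmap sub_inc sub_inc \o R _ T =
    R _ (tmap sub_inc sub_inc T) \o tmap sub_inc sub_inc)%VF.
  apply: lfun_tens_ext => a b; rewrite !comp_lfunE tmap_pure !RE.
  by have /lfunP/(_ T) := E a b; rewrite !comp_lfunE !LE.
by rewrite !comp_lfunE !RE.
Qed.

Lemma sub_comulM a b : sub_comul (a * b) = tmul (sub_comul a) (sub_comul b).
Proof.
by apply: tmap_inc_inj; rewrite tmul_inc !sub_comulE sub_incM comulM.
Qed.

Lemma sub_comul1 : sub_comul 1 = pure 1 1.
Proof.
by apply: tmap_inc_inj; rewrite tmap_pure sub_comulE sub_inc1 comul1.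
Qed.

Lemma sub_counitM a b : sub_counit (a * b) = sub_counit a * sub_counit b.
Proof. by rewrite !sub_counitE sub_incM counitM. Qed.

Lemma sub_counit1 : sub_counit 1 = 1.
Proof. by rewrite sub_counitE sub_inc1 counit1. Qed.

Lemma sub_antipodel a :
  tlift (fun x y => sub_antipode x * y) (sub_comul a) = sub_counit a *: 1.
Proof.
apply: sub_inc_inj; rewrite linear_tlift /= linearZ /= sub_inc1 sub_counitE.
rewrite -antipodel -sub_comulE tlift_tmap.
  by apply: eq_tlift => x y; rewrite sub_incM sub_antipodeE.
by split=> ? ? ? ?; rewrite ?linearP /= ?mulrDl ?mulrDr -?scalerAl -?scalerAr.
Qed.

Lemma sub_antipoder a :
  tlift (fun x y => x * sub_antipode y) (sub_comul a) = sub_counit a *: 1.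
Proof.
apply: sub_inc_inj; rewrite linear_tlift /= linearZ /= sub_inc1 sub_counitE.
rewrite -antipoder -sub_comulE tlift_tmap.
  by apply: eq_tlift => x y; rewrite sub_incM sub_antipodeE.
by split=> ? ? ? ?; rewrite ?linearP /= ?mulrDl ?mulrDr -?scalerAl -?scalerAr.
Qed.

Definition hopf_sub : hopfAlg (subvs_of A) :=
  HopfAlg sub_coassoc sub_counitl sub_counitr sub_comulM sub_comul1
    sub_counitM sub_counit1 sub_antipodel sub_antipoder.
End HopfSub.

Section Modules.
Variables (k : fieldType) (K : falgType k).

Record hmod := Hmod {
  hspace :> vectType k;
  hact : 'Hom(K, 'End(hspace));
  hact1 : hact 1 = \1%VF;
  hactM : forall a b, hact (a * b) = (hact a \o hact b)%VF
}.

Definition is_hom (V W : hmod) (f : 'Hom(V, W)) :=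
  forall a, (f \o hact V a = hact W a \o f)%VF.
Arguments is_hom : clear implicits.

(* Projective objects of the category of finite-dimensional modules. *)
Definition projective (P : hmod) :=
  forall (M N : hmod) (e : 'Hom(M, N)) (f : 'Hom(P, N)),
    is_hom M N e -> is_hom P N f -> limg e = fullv ->
    exists h : 'Hom(P, M), is_hom P M h /\ (e \o h)%VF = f.

Variable hK : hopfAlg K.

Section TensorModule.
Variables V W : hmod.

Let act2 (x y : K) : 'End(tens V W) := tmap (hact V x) (hact W y).

Lemma act2_bilin : bilin act2.
Proof.
split=> [y a x x'|x a y y']; apply: lfun_tens_ext => v w.
  rewrite add_lfunE scale_lfunE !tmap_pure linearP add_lfunE scale_lfunE.
  exact: pureDl.
rewrite add_lfunE scale_lfunE !tmap_pure linearP add_lfunE scale_lfunE.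
exact: pureDr.
Qed.

(* a acts by \sum a' (x) a''. *)
Definition tens_act : 'Hom(K, 'End(tens V W)) :=
  (linfun (tlift (fun x y => tmap (hact V x) (hact W y) : 'End(tens V W)))
     \o comul hK)%VF.

Lemma tens_actE a : tens_act a = tlift act2 (comul hK a).
Proof. by rewrite comp_lfunE lfunE. Qed.

Lemma tens_act1 : tens_act 1 = \1%VF.
Proof.
rewrite tens_actE comul1 (tlift_pure act2_bilin) /act2 !hact1.
exact: tmap_id.
Qed.

Lemma tens_actM a b : tens_act (a * b) = (tens_act a \o tens_act b)%VF.
Proof.
rewrite !tens_actE comulM.
set S := comul hK a; set T := comul hK b.
apply/lfunP => u; rewrite comp_lfunE /tmul linear_tlift !tlift_lfunE.
apply: eq_tlift => x y; rewrite linear_tlift !tlift_lfunE linear_tlift.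
apply: eq_tlift => x' y'; rewrite /= (tlift_pure act2_bilin) /act2 !hactM.
by rewrite -tmap_comp comp_lfunE.
Qed.

Definition tens_mod : hmod := Hmod tens_act1 tens_actM.
End TensorModule.

Record tensor_ideal (I : hmod -> Prop) : Prop := TensorIdeal {
  ideal_retract : forall (X Y : hmod) (i : 'Hom(X, Y)) (p : 'Hom(Y, X)),
    I Y -> is_hom X Y i -> is_hom Y X p -> (p \o i)%VF = \1%VF -> I X;
  ideal_tensr : forall X V : hmod, I X -> I (tens_mod X V);
  ideal_tensl : forall X V : hmod, I X -> I (tens_mod V X)
}.

End Modules.
Arguments is_hom {k K}.
Arguments projective {k K}.

Section PartialTrace.
Variables (k : fieldType) (K : falgType k) (g : K).
Implicit Types V X : hmod K.

(* As a vector space; partial traces do not involve the action on the dual. *)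
Definition dual (V : vectType k) : vectType k := 'Hom(V, k^o).

Definition dvec (V : vectType k) (i : 'I_(\dim {:V})) : dual V :=
  linfun (bcoord i : V -> k^o).

Definition hev V : 'Hom(tens (dual V) V, k^o) :=
  linfun (tlift (fun (xi : dual V) (v : V) => xi v)).
Definition hcoev V : 'Hom(k^o, tens V (dual V)) :=
  linfun (fun c : k^o => c *: \sum_i pure (bvec i) (dvec i)).
Definition hev' V : 'Hom(tens V (dual V), k^o) :=
  linfun (tlift (fun (v : V) (xi : dual V) => xi (hact V g v))).
Definition hcoev' V : 'Hom(k^o, tens (dual V) V) :=
  linfun (fun c : k^o => c *: \sum_i pure (dvec i) (hact V g^-1 (bvec i))).

Definition rptrace X V (f : 'End(tens X V)) : 'End(X) :=
  (tunitr X \o tmap \1 (hev' V) \o tassoc X V (dual V) \o tmap f \1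
     \o tassocV X V (dual V) \o tmap \1 (hcoev V) \o tunitrV X)%VF.

Definition lptrace X V (f : 'End(tens V X)) : 'End(X) :=
  (tunitl X \o tmap (hev V) \1 \o tassocV (dual V) V X \o tmap \1 f
     \o tassoc (dual V) V X \o tmap (hcoev' V) \1 \o tunitlV X)%VF.
End PartialTrace.

Section ModifiedTrace.
Variables (k : fieldType) (K : falgType k) (hK : hopfAlg K) (g : K).
Variable I : hmod K -> Prop.

(* A family of linear maps t_X : End_K(X) -> k indexed by X in I is encoded as
   a total function, of which only the values t X f with X in I and f
   K-linear are meaningful. *)
Definition trace_family := forall X : hmod K, 'End(X) -> k.
Variable t : trace_family.

Definition trace_linear :=
  forall (X : hmod K) (c : k) (f f' : 'End(X)),
    I X -> is_hom X X f -> is_hom X X f' ->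
    @t X (c *: f + f') = c * @t X f + @t X f'.

Definition trace_cyclic :=
  forall (X Y : hmod K) (f : 'Hom(X, Y)) (f' : 'Hom(Y, X)),
    I X -> I Y -> is_hom X Y f -> is_hom Y X f' ->
    @t X (f' \o f)%VF = @t Y (f \o f')%VF.

Record right_modified_trace : Prop := RightModifiedTrace {
  rmt_linear : trace_linear;
  rmt_cyclic : trace_cyclic;
  rmt_partial : forall (X V : hmod K) (f : 'End(tens_mod hK X V)),
    I X -> is_hom (tens_mod hK X V) (tens_mod hK X V) f ->
    @t (tens_mod hK X V) f = @t X (rptrace g f)
}.

Record left_modified_trace : Prop := LeftModifiedTrace {
  lmt_linear : trace_linear;
  lmt_cyclic : trace_cyclic;
  lmt_partial : forall (X V : hmod K) (f : 'End(tens_mod hK V X)),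
    I X -> is_hom (tens_mod hK V X) (tens_mod hK V X) f ->
    @t (tens_mod hK V X) f = @t X (lptrace g f)
}.

Definition nondegenerate_trace :=
  forall P P' : hmod K, I P -> I P' ->
  (forall f : 'Hom(P', P), is_hom P' P f ->
     (forall f' : 'Hom(P, P'), is_hom P P' f' -> @t P (f \o f')%VF = 0) ->
     f = 0) /\
  (forall f' : 'Hom(P, P'), is_hom P P' f' ->
     (forall f : 'Hom(P', P), is_hom P' P f -> @t P (f \o f')%VF = 0) ->
     f' = 0).
End ModifiedTrace.

Section Restriction.
Variables (k : fieldType) (H : falgType k) (hH : hopfAlg H) (A : {aspace H}).
Hypothesis hA : hopf_subalg hH A.
Variable V : hmod H.

Definition res_act : 'Hom(subvs_of A, 'End(V)) := (hact V \o sub_inc A)%VF.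

Lemma res_act1 : res_act 1 = \1%VF.
Proof. by rewrite comp_lfunE (sub_inc1 hA) hact1. Qed.
Lemma res_actM a b : res_act (a * b) = (res_act a \o res_act b)%VF.
Proof. by rewrite !comp_lfunE sub_incM hactM. Qed.

Definition res : hmod (subvs_of A) := Hmod res_act1 res_actM.
End Restriction.

(* Res is the identity on underlying spaces and linear maps. *)
Definition res_projective (k : fieldType) (H : falgType k) (hH : hopfAlg H)
    (A : {aspace H}) (hA : hopf_subalg hH A) (V : hmod H) : Prop :=
  projective (res hA V).

Definition pullback_trace (k : fieldType) (H : falgType k) (hH : hopfAlg H)
    (A : {aspace H}) (hA : hopf_subalg hH A)
    (tA : trace_family (subvs_of A)) : trace_family H :=
  fun V (f : 'End(V)) => tA (res hA V) f.

(* Main.v *)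
Require Import Defs.
From mathcomp Require Import all_boot all_algebra all_field.

Set Implicit Arguments.
Unset Strict Implicit.
Unset Printing Implicit Defensive.

Import GRing.Theory.
Local Open Scope ring_scope.

(** The restriction of an H-linear map is A-linear, so linearity and cyclicity
    of the pulled back trace are inherited from those of the trace on projective
    A-modules. For the partial trace property, restriction preserves tensor
    products (res_tens_act), hence an endomorphism of X (x) V has the same trace
    over A whether the tensor product is formed before or after restriction
    (trace_res_tens); and the partial traces over H and over A agree because
    they involve the algebra only through the pivot g, which lies in A
    (rptrace_res, lptrace_res).

    What remains is that projective A-modules are stable under retracts and
    under tensoring on both sides. For P (x) V one uses that a map out of
    P (x) V is the same as a map from P to the internal Hom from V, where the
    internal Hom functor is exact because everything is a vector space
    (projective_tensr). For V (x) P one applies this to the same algebra with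
    the opposite coproduct, whose modules tensor in the other order
    (projective_tensl). The latter is a Hopf algebra when the antipode S is
    invertible, and the pivot provides the inverse a |-> g^-1 * S a * g. *)

(** * Linear algebra of tensors *)

(** Closes goals F (a *: x + y) = a *: F x + F y where F is built from
    evaluations of linear maps, products, compositions, tensors and tlift: the
    sum is pushed outwards, and through tlift by descending into its summand. *)
Ltac linearity :=
  rewrite ?(linearP, mulrDl, mulrDr) -?scalerAl -?scalerAr
    ?(add_lfunE, scale_lfunE, pureDl, pureDr, linearP, mulrDl, mulrDr)
    -?scalerAl -?scalerAr
    ?(comp_lfunDl, comp_lfunDr) -?comp_lfunZl -?comp_lfunZr
    ?(comp_lfunDl, comp_lfunDr) -?comp_lfunZl -?comp_lfunZr /=;
  first [by [] | rewrite -tlift_linl; apply: eq_tlift => ? ? /=; linearity].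
Ltac linear_in := move=> ? ? ? /=; linearity.
Ltac bilinear := split=> [?|?]; linear_in.

Section Tensors.
Variable k : fieldType.
Implicit Types U V W : vectType k.

Lemma tlift_exchange V W V' W' (U : lmodType k) (f : V -> W -> V' -> W' -> U)
    (S : tens V W) (T : tens V' W') :
  tlift (fun x y => tlift (f x y) T) S =
  tlift (fun x' y' => tlift (fun x y => f x y x' y') S) T.
Proof.
rewrite /tlift !pair_big /=.
under eq_bigr => p _ do rewrite pair_big scaler_sumr /=.
rewrite exchange_big /=; apply: eq_bigr => q _.
rewrite pair_big scaler_sumr /=; apply: eq_bigr => p _.
by rewrite !scalerA mulrC.
Qed.

Lemma scale_bilinl (V : vectType k) : bilin (fun (c : k^o) (v : V) => c *: v).
Proof.
split=> [v a c d|c a v w]; first by rewrite scalerDl scalerA.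
by rewrite scalerDr !scalerA mulrC.
Qed.

Lemma scale_bilinr (V : vectType k) : bilin (fun (v : V) (c : k^o) => c *: v).
Proof. by have [L R] := scale_bilinl V. Qed.

Definition tflip V W : 'Hom(tens V W, tens W V) :=
  linfun (tlift (fun v w => pure w v)).

Lemma tflip_pure V W (v : V) (w : W) :
  tflip V W (pure v w) = pure w v.
Proof. by rewrite lfunE /= tlift_pure //; bilinear. Qed.

Lemma tflipK V W : (tflip W V \o tflip V W)%VF = \1%VF.
Proof.
by apply: lfun_tens_ext => v w; rewrite comp_lfunE !tflip_pure id_lfunE.
Qed.

Lemma tlift_flip V W (U : lmodType k) (f : W -> V -> U) T :
  bilin f -> tlift f (tflip V W T) = tlift (fun v w => f w v) T.
Proof.
move=> fB; rewrite [tflip _ _ _]lfunE /= linear_tlift.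
by apply: eq_tlift => v w /=; rewrite tlift_pure.
Qed.

Lemma pure_tlift U V W (X : vectType k) (f : V -> W -> X) (u : U) T :
  pure u (tlift f T) = tlift (fun v w => pure u (f v w)) T.
Proof.
have L : linear (fun x : X => pure u x) by linear_in.
rewrite -(linfunE L) linear_tlift; apply: eq_tlift => v w /=.
by rewrite (linfunE L).
Qed.

End Tensors.

(** * Calculus in a Hopf algebra *)

Section Sweedler.
Variables (k : fieldType) (K : falgType k) (hK : hopfAlg K).
Local Notation S := (antipode hK).

Local Notation "\sw_ ( x , y <- a ) E" := (tlift (fun x y => E) (comul hK a))
  (at level 36, x name, y name, a at level 36, E at level 36,
   format "\sw_ ( x ,  y  <-  a )  E").

(** Coassociativity as it is used under a Sweedler sum: the threefold sum of a
    trilinear f does not depend on which leg was split twice. *)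
Lemma sw_coassoc (U : vectType k) (f : K -> K -> K -> U) a :
  (forall y z, linear (fun x => f x y z)) ->
  (forall x z, linear (fun y => f x y z)) ->
  (forall x y, linear (f x y)) ->
  \sw_(x, z <- a) \sw_(x1, x2 <- x) f x1 x2 z =
  \sw_(x, z <- a) \sw_(z1, z2 <- z) f x z1 z2.
Proof.
move=> f1 f2 f3.
have B1 : bilin (fun x => tlift (f x)).
  split=> [T c x x'|x c T T']; last exact: linearP.
  by rewrite -tlift_linl; apply: eq_tlift => y z; rewrite f1.
have B2 : bilin (fun T z => tlift (fun x y => f x y z) T).
  split=> [z c T T'|T c z z']; first exact: linearP.
  by rewrite -tlift_linl; apply: eq_tlift => x y; rewrite f3.
transitivity (tlift (fun x => tlift (f x)) (tmap \1 (comul hK) (comul hK a))).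
  rewrite -coassoc [tassoc _ _ _ _]lfunE /= linear_tlift.
  pose B T z := tlift (fun x y => f x y z) T.
  rewrite -[LHS](_ : tlift B (tmap (comul hK) \1 (comul hK a)) = _).
    apply: eq_tlift => T z; rewrite linear_tlift; apply: eq_tlift => x y.
    by rewrite /= (tlift_pure B1) tlift_pure.
  by rewrite tlift_tmap //; apply: eq_tlift => x z; rewrite id_lfunE.
by rewrite tlift_tmap //; apply: eq_tlift => x z; rewrite id_lfunE.
Qed.

Lemma sw_counitl (U : vectType k) (f : K -> U) a : linear f ->
  \sw_(x, y <- a) (counit hK x *: f y) = f a.
Proof.
move=> fL; rewrite -[in RHS](counitl hK a) -(linfunE fL).
rewrite [tunitl _ _]lfunE /= tlift_tmap; last exact: scale_bilinl.
rewrite linear_tlift.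
by apply: eq_tlift => x y; rewrite id_lfunE linearZ /= (linfunE fL).
Qed.

Lemma sw_counitr (U : vectType k) (f : K -> U) a : linear f ->
  \sw_(x, y <- a) (counit hK y *: f x) = f a.
Proof.
move=> fL; rewrite -[in RHS](counitr hK a) -(linfunE fL).
rewrite [tunitr _ _]lfunE /= tlift_tmap; last exact: scale_bilinr.
rewrite linear_tlift.
by apply: eq_tlift => x y; rewrite id_lfunE linearZ /= (linfunE fL).
Qed.

Lemma sw_antipodel (U : vectType k) (f : K -> U) a : linear f ->
  \sw_(x, y <- a) f (S x * y) = counit hK a *: f 1.
Proof.
move=> fL; rewrite -(linfunE fL) -linearZ -antipodel.
rewrite [RHS](linear_tlift (linfun f) (fun x y => S x * y)).
by apply: eq_tlift => x y; rewrite /= (linfunE fL).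
Qed.

Lemma sw_antipoder (U : vectType k) (f : K -> U) a : linear f ->
  \sw_(x, y <- a) f (x * S y) = counit hK a *: f 1.
Proof.
move=> fL; rewrite -(linfunE fL) -linearZ -antipoder.
rewrite [RHS](linear_tlift (linfun f) (fun x y => x * S y)).
by apply: eq_tlift => x y; rewrite /= (linfunE fL).
Qed.

Lemma sw_mul (U : vectType k) (f : K -> K -> U) a b : bilin f ->
  tlift f (comul hK (a * b)) =
  \sw_(x, y <- a) \sw_(z, w <- b) f (x * z) (y * w).
Proof.
move=> fB; rewrite comulM /tmul linear_tlift; apply: eq_tlift => x y.
by rewrite linear_tlift; apply: eq_tlift => z w; rewrite /= tlift_pure.
Qed.

Lemma antipode1 : S 1 = 1.
Proof.
have := antipodel hK 1; rewrite comul1 tlift_pure; last by bilinear.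
by rewrite counit1 scale1r mulr1.
Qed.

(** Both (a, b) |-> S (a * b) and (a, b) |-> S b * S a are convolution inverses
    of multiplication, one on each side; so they agree. Bracketing the triple
    convolution product F of the three maps in both ways gives the proof. *)
Lemma antipodeM a b : S (a * b) = S b * S a.
Proof.
pose F x y z := \sw_(y1, y2 <- b) \sw_(u, v <- y1)
  (S (x * u) * (y * v) * (S y2 * S z)).
have F1 y z : linear (fun x => F x y z) by linear_in.
have F2 x z : linear (fun y => F x y z) by linear_in.
have F3 x y : linear (F x y) by linear_in.
have coassF := sw_coassoc a F1 F2 F3.
transitivity (\sw_(x, z <- a) \sw_(z1, z2 <- z) F x z1 z2).
  (* The last two legs of b cancel first, being innermost, then those of a. *)
  transitivity (\sw_(x, z <- a) (counit hK z *: S (x * b))).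
    by rewrite sw_counitr //; linear_in.
  apply: eq_tlift => x z.
  transitivity (\sw_(z1, z2 <- z) (S (x * b) * (z1 * S z2))).
    by rewrite (sw_antipoder (f := fun t => _ * t)) ?mulr1 //; linear_in.
  apply: eq_tlift => z1 z2.
  rewrite /F sw_coassoc; [|move=> *; linear_in..].
  rewrite -(sw_counitr (f := fun t => S (x * t) * (z1 * S z2)));
    last by linear_in.
  apply: eq_tlift => y w.
  rewrite -[z1 in LHS]mulr1.
  rewrite -(sw_antipoder (f := fun t => S (x * y) * (z1 * t * S z2)));
    last by linear_in.
  by apply: eq_tlift => w1 w2; rewrite !mulrA.
rewrite -coassF.
(* The first two legs of a and b give \sum S (x' y') * (x'' y''), the antipode
   identity for the product x * y. *)
transitivity (\sw_(x, z <- a) (counit hK x *: (S b * S z))); last first.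
  by rewrite (sw_counitl (f := fun t => S b * S t)) //; linear_in.
apply: eq_tlift => x z.
transitivity (\sw_(y, w <- b) (counit hK y *: (counit hK x *: (S w * S z))));
  last by rewrite (sw_counitl (f := fun t => counit hK x *: (S t * S z))) //;
          linear_in.
rewrite /F tlift_exchange; apply: eq_tlift => y w.
rewrite scalerA mulrC -counitM -[S w * S z in RHS]mul1r.
rewrite -(sw_antipodel (f := fun t => t * (S w * S z))); last by linear_in.
by rewrite sw_mul //; bilinear.
Qed.

(** * Projectivity of tensor products *)

Section InternalHom.
Variables V N : hmod K.

(** The summands of the internal Hom action
    (a phi)(v) = \sum a' (phi (S (a'') v)). *)
Definition ihom_term (x y : K) (phi : 'Hom(V, N)) : 'Hom(V, N) :=
  (hact N x \o phi \o hact V (S y))%VF.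

Lemma ihom_term_bilin phi : bilin (fun x y => ihom_term x y phi).
Proof. rewrite /ihom_term; bilinear. Qed.

Definition ihom_actv (a : K) (phi : 'Hom(V, N)) : 'Hom(V, N) :=
  \sw_(x, y <- a) ihom_term x y phi.

Lemma ihom_actv_linear a : linear (ihom_actv a).
Proof. rewrite /ihom_actv /ihom_term; linear_in. Qed.

Lemma ihom_act_linear : linear (fun a => linfun (ihom_actv a)).
Proof.
move=> c a b; apply/lfunP => phi.
rewrite add_lfunE scale_lfunE !(linfunE (@ihom_actv_linear _)).
by rewrite /ihom_actv !linearP.
Qed.

Definition ihom_act : 'Hom(K, 'End('Hom(V, N))) :=
  linfun (fun a => linfun (ihom_actv a)).

Lemma ihom_actE a phi : ihom_act a phi = \sw_(x, y <- a) ihom_term x y phi.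
Proof.
by rewrite (linfunE ihom_act_linear) (linfunE (@ihom_actv_linear a)).
Qed.

Lemma ihom_act1 : ihom_act 1 = \1%VF.
Proof.
apply/lfunP => phi; rewrite ihom_actE comul1 tlift_pure;
  last exact: ihom_term_bilin.
by rewrite /ihom_term antipode1 !hact1 comp_lfun1l comp_lfun1r id_lfunE.
Qed.

Lemma ihom_actM a b : ihom_act (a * b) = (ihom_act a \o ihom_act b)%VF.
Proof.
apply/lfunP => phi; rewrite comp_lfunE !ihom_actE sw_mul;
  last exact: ihom_term_bilin.
apply: eq_tlift => x y.
have L : linear (ihom_term x y) by rewrite /ihom_term; linear_in.
rewrite -[RHS](linfunE L) linear_tlift; apply: eq_tlift => z w /=.
by rewrite (linfunE L) /ihom_term antipodeM !hactM !comp_lfunA.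
Qed.

Definition ihom : hmod K := Hmod ihom_act1 ihom_actM.

End InternalHom.

Lemma ihom_comp_hom (V M N : hmod K) (e : 'Hom(M, N)) :
  is_hom M N e ->
  is_hom (ihom V M) (ihom V N) (linfun (fun phi => e \o phi)%VF).
Proof.
move=> eH a.
have L : linear (fun phi : 'Hom(V, M) => (e \o phi)%VF) by linear_in.
apply/lfunP => phi; rewrite !comp_lfunE !(linfunE L) !ihom_actE -(linfunE L).
rewrite linear_tlift; apply: eq_tlift => x y /=.
by rewrite (linfunE L) /ihom_term !comp_lfunA eH.
Qed.

Lemma tens_mod_pure (V W : hmod K) a v w :
  hact (tens_mod hK V W) a (pure v w) =
  \sw_(x, y <- a) pure (hact V x v) (hact W y w).
Proof.
rewrite /= tens_actE tlift_lfunE; apply: eq_tlift => x y.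
by rewrite tmap_pure.
Qed.

Section Currying.
Variables P V N : hmod K.

Definition curry (f : 'Hom(tens P V, N)) : 'Hom(P, 'Hom(V, N)) :=
  linfun (fun p => linfun (fun v => f (pure p v))).

Definition uncurry (h : 'Hom(P, 'Hom(V, N))) : 'Hom(tens P V, N) :=
  linfun (tlift (fun p v => h p v)).

Lemma curryE f p v : curry f p v = f (pure p v).
Proof.
have L q : linear (fun v => f (pure q v)) by linear_in.
rewrite /curry linfunE ?(linfunE (L p)) // => c q r.
by apply/lfunP => w; rewrite add_lfunE scale_lfunE !(linfunE (L _)); linearity.
Qed.

Lemma uncurry_pure h p v : uncurry h (pure p v) = h p v.
Proof. by rewrite lfunE /= tlift_pure //; bilinear. Qed.

(** Evaluating a (curry f p) at v gives
    \sum f (a' p (x) a'' (S (a''') v)), where the last two legs cancel. *)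
Lemma curry_hom f :
  is_hom (tens_mod hK P V) N f -> is_hom P (ihom V N) (curry f).
Proof.
move=> fH a; apply/lfunP => p; apply/lfunP => v.
rewrite !comp_lfunE curryE ihom_actE tlift_lfunE.
transitivity (\sw_(x, y <- a) (counit hK y *: f (pure (hact P x p) v))).
  by rewrite (sw_counitr (f := fun t => f (pure (hact P t p) v))) //; linear_in.
transitivity (\sw_(x, z <- a) \sw_(x1, x2 <- x)
    f (pure (hact P x1 p) (hact V (x2 * S z) v))); last first.
  apply: eq_tlift => x z; rewrite /ihom_term !comp_lfunE curryE.
  have /lfunP/(_ (pure p (hact V (S z) v))) := fH x.
  rewrite comp_lfunE tens_mod_pure [X in _ = X]comp_lfunE => <-.
  rewrite linear_tlift.
  by apply: eq_tlift => x1 x2; rewrite hactM comp_lfunE.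
rewrite (sw_coassoc
    (f := fun x y z => f (pure (hact P x p) (hact V (y * S z) v))));
  [|by move=> *; linear_in..].
apply: eq_tlift => x z.
rewrite (sw_antipoder (f := fun t => f (pure (hact P x p) (hact V t v)))).
  by rewrite hact1 id_lfunE.
by linear_in.
Qed.

(** Dually, uncurry h (a (p (x) v)) = \sum a' (h p (S (a'') (a''' v))). *)
Lemma uncurry_hom h :
  is_hom P (ihom V N) h -> is_hom (tens_mod hK P V) N (uncurry h).
Proof.
move=> hH a; apply: lfun_tens_ext => p v.
rewrite comp_lfunE tens_mod_pure [RHS]comp_lfunE uncurry_pure linear_tlift.
transitivity (\sw_(x, z <- a) \sw_(x1, x2 <- x)
    hact N x1 (h p (hact V (S x2 * z) v))).
  apply: eq_tlift => x y; rewrite /= uncurry_pure.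
  have /lfunP/(_ p) := hH x; rewrite !comp_lfunE => ->.
  rewrite ihom_actE tlift_lfunE; apply: eq_tlift => x1 x2.
  by rewrite /ihom_term !comp_lfunE hactM comp_lfunE.
rewrite (sw_coassoc (f := fun x y z => hact N x (h p (hact V (S y * z) v))));
  [|by move=> *; linear_in..].
rewrite -(sw_counitr (f := fun t => hact N t (h p v))); last by linear_in.
apply: eq_tlift => x z.
rewrite (sw_antipodel (f := fun t => hact N x (h p (hact V t v)))).
  by rewrite hact1 id_lfunE.
by linear_in.
Qed.

End Currying.

(** Tensoring with V on the right is left adjoint to the internal Hom out of V,
    by currying. Postcomposition with a surjective e is surjective on internal
    Homs, since e has a linear section; lifting the curried map along it and
    uncurrying lifts the original map. *)
Lemma projective_tensr (P V : hmod K) :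
  projective P -> projective (tens_mod hK P V).
Proof.
move=> PP M N e f eH fH eS.
pose E : 'Hom('Hom(V, M), 'Hom(V, N)) := linfun (fun phi => e \o phi)%VF.
have EE phi : E phi = (e \o phi)%VF by rewrite linfunE //; linear_in.
have ES : limg E = fullv.
  apply/vspaceP => psi; rewrite memvf.
  have -> : psi = E (e^-1 \o psi)%VF.
    by apply/lfunP => v; rewrite EE !comp_lfunE limg_lfunVK // eS memvf.
  by rewrite memv_img ?memvf.
have [h [hH Eh]] := PP (ihom V M) (ihom V N) E (curry f)
  (ihom_comp_hom V eH) (curry_hom fH) ES.
exists (uncurry h); split; first exact: uncurry_hom.
apply: lfun_tens_ext => p v; rewrite comp_lfunE uncurry_pure -curryE -Eh.
by rewrite comp_lfunE EE comp_lfunE.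
Qed.

End Sweedler.

Lemma projective_retract (k : fieldType) (K : falgType k) (X Y : hmod K)
    (i : 'Hom(X, Y)) (p : 'Hom(Y, X)) :
  is_hom X Y i -> is_hom Y X p -> (p \o i)%VF = \1%VF ->
  projective Y -> projective X.
Proof.
move=> iH pH pi PY M N e f eH fH eS.
have [|h [hH eh]] := PY M N e (f \o p)%VF eH _ eS.
  by move=> a; rewrite -comp_lfunA pH !comp_lfunA fH.
exists (h \o i)%VF; split.
  by move=> a; rewrite -comp_lfunA iH !comp_lfunA hH.
by rewrite comp_lfunA eh -comp_lfunA pi comp_lfun1r.
Qed.

(** * The co-opposite Hopf algebra *)

Lemma grouplike_unit (k : fieldType) (K : falgType k) (hK : hopfAlg K) (g : K) :
  grouplike hK g -> g \is a GRing.unit.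
Proof.
move=> [gg eg]; apply/unitrP; exists (antipode hK g); split.
  by have := antipodel hK g; rewrite gg tlift_pure ?eg ?scale1r //; bilinear.
by have := antipoder hK g; rewrite gg tlift_pure ?eg ?scale1r //; bilinear.
Qed.

Section Coopposite.
Variables (k : fieldType) (K : falgType k) (hK : hopfAlg K) (g : K).
Hypothesis gP : pivotal hK g.
Local Notation S := (antipode hK).

Definition cop_comul : 'Hom(K, tens K K) := (tflip K K \o comul hK)%VF.

(** The inverse of S: since S (S a) = g * a * g^-1, the inverse of S is
    conjugation by g^-1 after S. *)
Definition cop_antipode : 'End(K) := linfun (fun a => g^-1 * S a * g).

Lemma cop_antipodeE a : cop_antipode a = g^-1 * S a * g.
Proof. by rewrite linfunE //; linear_in. Qed.

Lemma tlift_cop (U : lmodType k) (f : K -> K -> U) a : bilin f ->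
  tlift f (cop_comul a) = tlift (fun x y => f y x) (comul hK a).
Proof. by move=> fB; rewrite comp_lfunE tlift_flip. Qed.

Lemma cop_coassoc a :
  tassoc _ _ _ (tmap cop_comul \1%VF (cop_comul a)) =
  tmap \1%VF cop_comul (cop_comul a).
Proof.
rewrite [tmap _ _ _]lfunE /= linear_tlift /=.
rewrite [RHS]lfunE /= !tlift_cop; try by bilinear.
transitivity (tlift (fun x z =>
    tlift (fun z1 z2 => pure z2 (pure z1 x)) (comul hK z)) (comul hK a)
  : tens K (tens K K)).
  apply: eq_tlift => x z; rewrite id_lfunE [tassoc _ _ _ _]lfunE /=.
  rewrite tlift_pure; last by bilinear.
  by rewrite tlift_cop //; bilinear.
rewrite -(sw_coassoc hK (f := fun x y z => pure z (pure y x)));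
  [|by move=> *; linear_in..].
apply: eq_tlift => x z; rewrite id_lfunE.
by rewrite [cop_comul x]comp_lfunE [tflip _ _ _]lfunE /= pure_tlift.
Qed.

Lemma cop_counitl a : tunitl _ (tmap (counit hK) \1%VF (cop_comul a)) = a.
Proof.
rewrite [tmap _ _ _]lfunE /= linear_tlift /= tlift_cop; last by bilinear.
rewrite -[RHS](sw_counitr hK (f := id)) //; apply: eq_tlift => x y.
by rewrite tunitl_pure id_lfunE.
Qed.

Lemma cop_counitr a : tunitr _ (tmap \1%VF (counit hK) (cop_comul a)) = a.
Proof.
rewrite [tmap _ _ _]lfunE /= linear_tlift /= tlift_cop; last by bilinear.
rewrite -[RHS](sw_counitl hK (f := id)) //; apply: eq_tlift => x y.
by rewrite tunitr_pure id_lfunE.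
Qed.

Lemma cop_comulM a b : cop_comul (a * b) = tmul (cop_comul a) (cop_comul b).
Proof.
rewrite [LHS]comp_lfunE [tflip _ _ _]lfunE /= sw_mul; last by bilinear.
rewrite {1}/tmul tlift_cop; last by bilinear.
apply: eq_tlift => x y; rewrite tlift_cop //; bilinear.
Qed.

Lemma cop_comul1 : cop_comul 1 = pure 1 1.
Proof. by rewrite comp_lfunE comul1 tflip_pure. Qed.

(** The identity is the image under g^-1 * S _ * g of the antipode identity of
    hK, since S (S x) * g = g * x turns g^-1 * S (S x * y) * g into the summand. *)
Lemma cop_antipodel a :
  tlift (fun x y => cop_antipode x * y) (cop_comul a) = counit hK a *: (1 : K).
Proof.
have [_ S2] := gP; have gU := grouplike_unit gP.1.
rewrite tlift_cop; last by bilinear.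
transitivity (tlift (fun x y => g^-1 * S (S x * y) * g) (comul hK a)).
  apply: eq_tlift => x y; rewrite cop_antipodeE antipodeM S2 !mulrA.
  by rewrite mulrVK.
rewrite (sw_antipodel hK (f := fun t => g^-1 * S t * g)); last by linear_in.
by rewrite antipode1 mulr1 mulVr.
Qed.

Lemma cop_antipoder a :
  tlift (fun x y => x * cop_antipode y) (cop_comul a) = counit hK a *: (1 : K).
Proof.
have [_ S2] := gP; have gU := grouplike_unit gP.1.
rewrite tlift_cop; last by bilinear.
transitivity (tlift (fun x y => g^-1 * S (x * S y) * g) (comul hK a)).
  apply: eq_tlift => x y; rewrite cop_antipodeE antipodeM S2 !mulrA.
  by rewrite mulVr // mul1r.
rewrite (sw_antipoder hK (f := fun t => g^-1 * S t * g)); last by linear_in.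
by rewrite antipode1 mulr1 mulVr.
Qed.

(** K with the opposite coproduct. Its tensor product is that of hK with the
    factors exchanged, so that statements about tensoring on the right transfer
    to tensoring on the left. *)
Definition cop : hopfAlg K :=
  HopfAlg cop_coassoc cop_counitl cop_counitr cop_comulM cop_comul1
    (@counitM _ _ hK) (counit1 hK) cop_antipodel cop_antipoder.

Lemma tflip_hom (V W : hmod K) :
  is_hom (tens_mod hK V W) (tens_mod cop W V) (tflip V W).
Proof.
move=> a; apply: lfun_tens_ext => v w.
rewrite comp_lfunE tens_mod_pure linear_tlift [RHS]comp_lfunE tflip_pure.
rewrite tens_mod_pure tlift_cop; last by bilinear.
by apply: eq_tlift => x y; rewrite /= tflip_pure.
Qed.

Lemma tflip_cop_hom (V W : hmod K) :
  is_hom (tens_mod cop V W) (tens_mod hK W V) (tflip V W).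
Proof.
move=> a; apply: lfun_tens_ext => v w.
rewrite comp_lfunE tens_mod_pure linear_tlift [RHS]comp_lfunE tflip_pure.
rewrite tens_mod_pure tlift_cop; last by bilinear.
by apply: eq_tlift => x y; rewrite /= tflip_pure.
Qed.

(** The flip identifies this module with the tensor product over cop in which
    P is the left factor, the case of projective_tensr. *)
Lemma projective_tensl (P V : hmod K) :
  projective P -> projective (tens_mod hK V P).
Proof.
move=> PP; apply: (projective_retract (Y := tens_mod cop P V)
  (@tflip_hom V P) (@tflip_cop_hom P V) (tflipK V P)).
exact: projective_tensr.
Qed.
End Coopposite.

(** * Restriction to the Hopf subalgebra *)

Section Restriction.
Variables (k : fieldType) (H : falgType k) (hH : hopfAlg H).
Variables (A : {aspace H}) (hA : hopf_subalg hH A).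
Local Notation R := (res hA).

Lemma hact_res (V : hmod H) a : hact (R V) a = hact V (sub_inc A a).
Proof. by rewrite [LHS]comp_lfunE. Qed.

Lemma hom_res (V W : hmod H) (f : 'Hom(V, W)) :
  is_hom V W f -> is_hom (R V) (R W) f.
Proof. by move=> fH a; rewrite !hact_res fH. Qed.

(** Res is strictly monoidal on underlying spaces: both modules live on
    tens V W and have the same action, so that they are isomorphic through the
    identity map. *)
Lemma res_tens_act (V W : hmod H) a :
  hact (R (tens_mod hH V W)) a = hact (tens_mod (hopf_sub hA) (R V) (R W)) a.
Proof.
apply: lfun_tens_ext => v w.
rewrite hact_res [LHS]tens_mod_pure.
apply: etrans (esym (@tens_mod_pure _ _ (hopf_sub hA) (R V) (R W) a v w)).
rewrite -(sub_comulE hA) tlift_tmap; last by bilinear.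
by apply: eq_tlift => x y; rewrite !hact_res.
Qed.

Lemma id_hom_res_tens (V W : hmod H) :
  is_hom (R (tens_mod hH V W)) (tens_mod (hopf_sub hA) (R V) (R W)) \1%VF.
Proof. by move=> a; rewrite comp_lfun1l comp_lfun1r res_tens_act. Qed.

Lemma id_hom_tens_res (V W : hmod H) :
  is_hom (tens_mod (hopf_sub hA) (R V) (R W)) (R (tens_mod hH V W)) \1%VF.
Proof. by move=> a; rewrite comp_lfun1l comp_lfun1r res_tens_act. Qed.

Lemma projective_res_tens (V W : hmod H) :
  projective (tens_mod (hopf_sub hA) (R V) (R W)) ->
  projective (R (tens_mod hH V W)).
Proof.
apply: projective_retract (id_hom_res_tens V W) (id_hom_tens_res V W) _.
exact: comp_lfun1l.
Qed.

Lemma res_hom_tens (V W : hmod H) (f : 'End(tens_mod hH V W)) :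
  is_hom (tens_mod hH V W) (tens_mod hH V W) f ->
  is_hom (tens_mod (hopf_sub hA) (R V) (R W))
         (tens_mod (hopf_sub hA) (R V) (R W)) f.
Proof. by move=> /hom_res fH a; rewrite -!res_tens_act. Qed.

(** Cyclicity along the identity isomorphism. *)
Lemma trace_res_tens (tA : trace_family (subvs_of A)) (V W : hmod H)
    (f : 'End(tens_mod hH V W)) :
  trace_cyclic projective tA ->
  projective (tens_mod (hopf_sub hA) (R V) (R W)) ->
  is_hom (tens_mod hH V W) (tens_mod hH V W) f ->
  tA (R (tens_mod hH V W)) f = tA (tens_mod (hopf_sub hA) (R V) (R W)) f.
Proof.
move=> cyc P fH.
pose i : 'Hom(R (tens_mod hH V W), tens_mod (hopf_sub hA) (R V) (R W)) :=
  \1%VF.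
have := cyc _ _ i f (projective_res_tens P) P (id_hom_res_tens V W).
rewrite /i comp_lfun1l comp_lfun1r; apply=> a.
by rewrite -res_tens_act; exact: hom_res fH a.
Qed.

Variables (g : H) (gP : pivotal hH g) (gA : g \in A).

Lemma sub_inc_pivot : sub_inc A (Subvs gA) = g.
Proof. by rewrite sub_incE. Qed.

Lemma pivotal_sub : pivotal (hopf_sub hA) (Subvs gA).
Proof.
have [[gg eg] S2] := gP; have gU := grouplike_unit gP.1.
have gS : grouplike (hopf_sub hA) (Subvs gA).
  split; last by rewrite /= sub_counitE sub_inc_pivot.
  apply: (@tmap_inc_inj _ _ A).
  by rewrite /= (sub_comulE hA) tmap_pure !sub_inc_pivot.
split=> // a; apply: (@sub_inc_inj _ _ A).
have gSU : Subvs gA \is a GRing.unit by apply: grouplike_unit gS.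
apply: (mulIr gU); rewrite /= !(sub_antipodeE hA) S2 mulrVK //.
rewrite -[X in _ = _ * X]sub_inc_pivot.
by rewrite -sub_incM mulrVK // sub_incM sub_inc_pivot.
Qed.

(** The inverse in A is a priori taken relative to the ring structure of A; it
    is that of H because A contains the unit of H and the pivot of A, being
    grouplike, is invertible there. *)
Lemma sub_inc_pivotV : sub_inc A (Subvs gA)^-1 = g^-1.
Proof.
have gU := grouplike_unit gP.1; have sU := grouplike_unit pivotal_sub.1.
apply: (mulrI gU); rewrite divrr // -{1}sub_inc_pivot -sub_incM divrr //.
exact: sub_inc1 hA.
Qed.

Lemma rptrace_res (X V : hmod H) (f : 'End(tens_mod hH X V)) :
  rptrace (K := subvs_of A) (Subvs gA) (X := R X) (V := R V) f = rptrace g f.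
Proof.
by rewrite /rptrace /hev' hact_res sub_inc_pivot.
Qed.

Lemma lptrace_res (X V : hmod H) (f : 'End(tens_mod hH V X)) :
  lptrace (K := subvs_of A) (Subvs gA) (X := R X) (V := R V) f = lptrace g f.
Proof.
by rewrite /lptrace /hcoev' hact_res sub_inc_pivotV.
Qed.
End Restriction.

Theorem corollary2p8 (k : fieldType) (H : falgType k) (hH : hopfAlg H) (g : H)
    (Hpiv : pivotal hH g)
    (A : {aspace H}) (hA : hopf_subalg hH A) (uA : unimodular (hopf_sub hA))
    (gA : g \in A) :
  tensor_ideal hH (res_projective hA) /\
  (forall tA : trace_family (subvs_of A),
     right_modified_trace (hopf_sub hA) (Subvs gA) projective tA ->
     nondegenerate_trace projective tA ->
     right_modified_trace hH g (res_projective hA) (pullback_trace hA tA)) /\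
  (forall tA : trace_family (subvs_of A),
     left_modified_trace (hopf_sub hA) (Subvs gA) projective tA ->
     nondegenerate_trace projective tA ->
     left_modified_trace hH g (res_projective hA) (pullback_trace hA tA)).
Proof.
have gS := pivotal_sub hA Hpiv gA.
split; [split|split=> tA [lin cyc part] _; split].
- move=> X Y i p PY /(hom_res hA) iH /(hom_res hA) pH pi.
  exact: projective_retract iH pH pi PY.
- by move=> X V PX; apply/projective_res_tens/projective_tensr.
- by move=> X V PX; apply/projective_res_tens/(projective_tensl gS).
- move=> X c f f' PX /(hom_res hA) fH /(hom_res hA) fH'; exact: lin.
- move=> X Y f f' PX PY /(hom_res hA) fH /(hom_res hA) fH'.
  exact: cyc PX PY fH fH'.
- move=> X V f PX fH; rewrite /pullback_trace trace_res_tens //.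
    by rewrite part //; [rewrite rptrace_res | exact: res_hom_tens].
  exact: projective_tensr.
- move=> X c f f' PX /(hom_res hA) fH /(hom_res hA) fH'; exact: lin.
- move=> X Y f f' PX PY /(hom_res hA) fH /(hom_res hA) fH'.
  exact: cyc PX PY fH fH'.
- move=> X V f PX fH; rewrite /pullback_trace trace_res_tens //.
    by rewrite part //; [rewrite lptrace_res | exact: res_hom_tens].
  exact: (projective_tensl gS).
Qed.
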